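(* Let $(G,S)$ be a Cayley graph of a group of polynomial growth with homogeneous dimension $N\geq3$, and let $1<p<N$. Then $D_0^{1,p}(G)=D^{1,p}(G)$.
   Context: $G$ is a finitely generated group and $S$ a finite generating set with $S=S^{-1}$. The Cayley graph $(G,S)$ has vertex set $G$, and $x\sim y$ iff $x=ys$ for some $s\in S$. $\beta_S(n)$ is the number of elements of $G$ at word distance at most $n$ from the unit element. $G$ is of polynomial growth with homogeneous dimension $N\in\mathbb N$ if there are constants $C_1,C_2>0$ depending on $S$ with $C_1n^N\le\beta_S(n)\le C_2n^N$ for all $n\ge1$. For $u:G\to\mathbb R$, $\lVert u\rVert_{D^{1,p}(G)}:=\left(\sum_{x\in G}\sum_{y\sim x}|u(y)-u(x)|^p\right)^{1/p}$. $D_0^{1,p}(G)$ is the completion of the finitely supported functions in this norm, its elements being regarded as functions on $G$ (a Cauchy sequence of finitely supported functions is identified with its pointwise limit), and $D^{1,p}(G):=\{u\in\ell^{\frac{Np}{N-p}}(G):\lVert u\rVert_{D^{1,p}(G)}<\infty\}$. *)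

(* Defs.v *)
From HB Require Import structures.
From mathcomp Require Import all_boot all_order all_algebra finmap.
From mathcomp Require Import all_classical all_reals all_analysis.

Set Implicit Arguments.
Unset Strict Implicit.
Unset Printing Implicit Defensive.

Import Order.TTheory GRing.Theory Num.Theory.
Import numFieldNormedType.Exports.

Local Open Scope classical_set_scope.
Local Open Scope ring_scope.

Section CayleyGraph.
Variable G : groupType.
Implicit Types (S H : set G) (x y : G).

Definition is_subgroup H : Prop :=
  [/\ H 1%g, forall x y, H x -> H y -> H (x * y)%g & forall x, H x -> H x^-1%g].

Definition generates S : Prop := smallest is_subgroup S = [set: G].

Definition symmetric_set S : Prop := [set x^-1%g | x in S] = S.

Definition cayley_adj S x y : Prop := exists2 s, S s & x = (y * s)%g.

Definition is_word S (w : seq G) x : Prop :=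
  (forall s, s \in w -> S s) /\ x = \big[*%g/1%g]_(s <- w) s.

Definition word_of_length S x (n : nat) : bool :=
  `[< exists2 w, is_word S w x & size w = n >].

(* The value 0 in the second branch is junk: that branch does not occur when S *)
(* generates G and is symmetric.                                               *)
Definition word_length S x : nat :=
  if pselect (exists n, word_of_length S x n) is left ex_n then ex_minn ex_n
  else 0%N.

Definition word_dist S x y : nat := word_length S (x^-1 * y)%g.

(* [fset_set] sends infinite sets to the empty finite set; these balls are     *)
(* finite when S is finite, generating and symmetric.                          *)
Definition growth S (n : nat) : nat :=
  #|` fset_set [set x | (word_dist S 1%g x <= n)%N] |.

Definition polynomial_growth (R : realType) S (N : nat) : Prop :=
  exists C1 C2 : R, [/\ 0 < C1, 0 < C2 & forall n : nat, (1 <= n)%N ->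
    C1 * n%:R ^+ N <= (growth S n)%:R <= C2 * n%:R ^+ N].

End CayleyGraph.

Section Spaces.
Variables (R : realType) (G : groupType).
Implicit Types (S : set G) (p q : R) (u : G -> R).

Definition D1p_norm S p u : \bar R :=
  ((\esum_(x in [set: G]) \esum_(y in [set y | cayley_adj S y x])
      (`|u y - u x| `^ p)%:E) `^ p^-1)%E.

Definition ell q : set (G -> R) :=
  [set u | (\esum_(x in [set: G]) (`|u x| `^ q)%:E < +oo)%E].

Definition finitely_supported u : Prop := finite_set [set x | u x != 0].

Definition D1p_cauchy S p (v : nat -> G -> R) : Prop :=
  forall e : R, 0 < e -> exists K : nat, forall m n : nat,
    (K <= m)%N -> (K <= n)%N -> (D1p_norm S p (v m \- v n)%R < e%:E)%E.

(* The completion of the finitely supported functions, realised as a space of  *)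
(* functions: the class of a Cauchy sequence is its pointwise limit.           *)
Definition D1p_0 S p : set (G -> R) :=
  [set u | exists v : nat -> G -> R,
    [/\ forall k, finitely_supported (v k), D1p_cauchy S p v
      & forall x, v k x @[k --> \oo] --> u x]].

Definition D1p S (N : nat) p : set (G -> R) :=
  [set u | ell (N%:R * p / (N%:R - p)) u /\ (D1p_norm S p u < +oo)%E].

End Spaces.

(* Main.v *)
Require Import Defs.
From mathcomp Require Import all_boot all_order all_algebra finmap.
From mathcomp Require Import all_classical all_reals all_analysis.
From mathcomp Require Import ring lra zify.

(** Write E(f) for the p-th power of the norm of f, that is the sum of
    |f(xs) - f(x)|^p over the directed edges (x, xs), and q = Np/(N - p).

    The inclusion of D^{1,p} in D_0^{1,p} is a truncation argument
    (sub_D1p_0).  If u is in l^q, every set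
    {|u| >= e} with e > 0 is finite, so soft thresholding
    u - clip_e(u), clip_e being the projection of the line onto [-e, e],
    yields finitely supported functions, and they converge to u uniformly as
    e tends to 0.  Clipping is 1-Lipschitz, so the edge differences of
    clip_e(u) are dominated by those of u and are at most 2e; by dominated
    convergence their energy tends to 0.

    The converse inclusion (D1p_0_sub) rests on the Sobolev inequality
      sum |f|^q <= C E(f)^{N/(N - p)}     for finitely supported f,
    with C independent of f (sobolev).  A Cauchy sequence of finitely supported
    functions has bounded energy, hence is bounded in l^q, and both bounds pass
    to the pointwise limit by Fatou (esum_lim_le).

    The Sobolev inequality is obtained from the volume growth by cutting f >= 0
    into dyadic slabs.  Let t_k = eps 2^k, let f_k be the part of f between the
    heights t_k and 2 t_k, and let a_k be the number of points with f >= t_k.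
    - Translating by an element of word length at most n costs n^p E
      (energy_translate).
    - f_k equals t_k at a_{k+1} points and vanishes off a set of a_k points.
      If the ball of radius n has at least 2 a_k elements, then from each of the
      a_{k+1} points at least half of the translations by the ball leave that
      set, and each of these sees a difference t_k.  Averaging over the ball,
      a_{k+1} t_k^p <= 2 n^p E(f_k)  (plateau_le).
    - As the ball of radius n has at least C1 n^N elements, n may be taken of
      order a_k^{1/N}, so a_{k+1} t_k^p <= D a_k^{p/N} E(f_k)
      (plateau_capacity_le).
    - The slabs split the energy: sum_k E(f_k) <= E(f) (sum_energy_slab_le).
    - With th = p/N and b_k = t_k^q a_k, the exponent q is the one for which
      the powers of t_k cancel: b_{k+1} <= C b_k^th E(f_k).  Summing over k
      gives B <= b_0 + C B^th E(f) for B = sum_k b_k, which can be solved for B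
      because th < 1 (dyadic_sum_le).  Finally sum f^q is comparable to B up to
      terms that vanish with eps. *)

Set Implicit Arguments.
Unset Strict Implicit.
Unset Printing Implicit Defensive.

Import Order.TTheory GRing.Theory Num.Theory.
Import numFieldNormedType.Exports.

Local Open Scope classical_set_scope.
Local Open Scope ring_scope.

(** * Unconditional sums of nonnegative reals *)

Section Sums.
Variables (R : realType) (T : choiceType).
Implicit Types (I : set T) (a b : T -> R) (r : seq T).

(** Reduces extended sums to finite sums of reals, where ring and order reasoning
    is available and scalars can be factored out freely. *)
Lemma esum_le_finP I a (M : R) : (forall i, I i -> 0 <= a i) ->
  (\esum_(i in I) (a i)%:E <= M%:E)%E <->
  (forall r, uniq r -> {in r, forall i, I i} -> \sum_(i <- r) a i <= M).
Proof.
move=> a0; split=> [le r ur rI|le].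
  rewrite -lee_fin -sumEFin; apply: le_trans le; apply: esum_ge.
  exists [set` r]; first by split; [by apply/finite_seqP; exists r | exact: rI].
  by rewrite -fsbig_seq.
apply: ge_ereal_sup => /= _ [X [finX XI]] <-.
rewrite fsbig_finite// sumEFin lee_fin le// => i.
by rewrite in_fset_set// inE => /XI.
Qed.

Lemma esum_ltyP I a : (forall i, I i -> 0 <= a i) ->
  (\esum_(i in I) (a i)%:E < +oo)%E <->
  exists M, forall r, uniq r -> {in r, forall i, I i} -> \sum_(i <- r) a i <= M.
Proof.
move=> a0; split=> [fin|[M /(esum_le_finP _ a0) le]]; last first.
  exact: le_lt_trans le (ltry _).
exists (fine (\esum_(i in I) (a i)%:E)); apply/(esum_le_finP _ a0).
by rewrite fineK// ge0_fin_numE// esum_ge0// => i /a0; rewrite lee_fin.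
Qed.

End Sums.

(** * Real powers and dyadic slabs *)

Section Powers.
Variable R : realType.
Implicit Types (p a b s t eps : R).

Lemma ler_powRl p a b : 0 <= p -> 0 <= a -> a <= b -> a `^ p <= b `^ p.
Proof.
by move=> p0 a0 ab; rewrite ge0_ler_powR ?nnegrE ?(le_trans a0 ab).
Qed.

(** x^p = x x^(p - 1), and the second factor is monotone because p >= 1. *)
Lemma powRD_ge p a b : 1 <= p -> 0 <= a -> 0 <= b ->
  a `^ p + b `^ p <= (a + b) `^ p.
Proof.
move=> p1 a0 b0; have p0 : 0 < p by rewrite (lt_le_trans _ p1).
rewrite -(mulr_powRB1 a0 p0) -(mulr_powRB1 b0 p0).
rewrite -(mulr_powRB1 (addr_ge0 a0 b0) p0) mulrDl.
rewrite lerD// ler_wpM2l// ler_powRl ?subr_ge0//.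
  by rewrite lerDl.
by rewrite lerDr.
Qed.

Lemma powR_sum_ge (I : Type) (r : seq I) (d : I -> R) p : 1 <= p ->
  (forall i, 0 <= d i) -> \sum_(i <- r) d i `^ p <= (\sum_(i <- r) d i) `^ p.
Proof.
move=> p1 d0; elim: r => [|i r ih]; first by rewrite !big_nil powR_ge0.
rewrite !big_cons (le_trans _ (powRD_ge p1 _ _))// ?lerD2l//.
by rewrite sumr_ge0.
Qed.

Lemma powR_normD_le p a b : 0 <= p ->
  `|a + b| `^ p <= 2 `^ p * (`|a| `^ p + `|b| `^ p).
Proof.
move=> p0; wlog ab : a b / `|a| <= `|b| => [th|].
  have [/th//|/ltW/th] := leP `|a| `|b|.
  by rewrite addrC [X in _ * X]addrC.
rewrite mulrDr (@le_trans _ _ (2 `^ p * `|b| `^ p))//; last first.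
  by rewrite lerDr mulr_ge0// powR_ge0.
rewrite -powRM// ler_powRl// (le_trans (ler_normD _ _))//.
by rewrite mulr_natl mulr2n lerD2r.
Qed.

(** Convexity of the p-th power applied to the convex combination of
    a(s + t)/s and b(s + t)/t with weights s/(s + t) and t/(s + t). With s = n and
    t = 1 this is what makes n steps cost n^p rather than a larger constant. *)
Lemma powRD_weighted_le p a b s t : 1 <= p -> 0 <= a -> 0 <= b ->
    0 < s -> 0 < t ->
  (a + b) `^ p <=
    (s + t) `^ (p - 1) * (a `^ p / s `^ (p - 1) + b `^ p / t `^ (p - 1)).
Proof.
move=> p1 a0 b0 s0 t0; have p0 : 0 < p by rewrite (lt_le_trans _ p1).
have st0 : 0 < s + t by rewrite addr_gt0.
have w0 : 0 <= s / (s + t) by rewrite divr_ge0// ltW.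
have w1 : s / (s + t) <= 1 by rewrite ler_pdivrMr// mul1r lerDl ltW.
have stN0 : s + t != 0 by rewrite gt_eqF.
have sN0 : s != 0 by rewrite gt_eqF.
have tN0 : t != 0 by rewrite gt_eqF.
have x0 : 0 <= a * (s + t) / s by rewrite divr_ge0 ?mulr_ge0// ltW.
have y0 : 0 <= b * (s + t) / t by rewrite divr_ge0 ?mulr_ge0// ltW.
set w := s / (s + t) in w0 w1; set x := a * (s + t) / s in x0.
set y := b * (s + t) / t in y0.
have : (w * x + (1 - w) * y) `^ p <= w * x `^ p + (1 - w) * y `^ p.
  by apply: (convex_powR p1 (Itv01 w0 w1));
    rewrite inE/= in_itv/= andbT.
have -> : w * x + (1 - w) * y = a + b.
  by rewrite /w /x /y; field; rewrite stN0 sN0 tN0.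
rewrite /w /x /y {w x y w0 w1 x0 y0}.
move=> /le_trans; apply; rewrite le_eqVlt; apply/orP; left; apply/eqP.
have i0 c : 0 < c -> 0 <= c^-1 by move=> /ltW; rewrite invr_ge0.
rewrite !powRM ?mulr_ge0 ?i0// ?(ltW st0)//.
have invp c : 0 < c -> c^-1 `^ p = (c * c `^ (p - 1))^-1.
  move=> c0; rewrite mulr_powRB1 ?ltW// -(powR_inv1 (ltW c0)).
  by rewrite -(powR_inv1 (powR_ge0 c p)); exact: powRAC.
rewrite !invp// -(mulr_powRB1 (ltW st0) p0).
field; rewrite ?stN0 ?sN0 ?tN0 ?gt_eqF ?powR_gt0//.
Qed.

(** The part of s lying between the heights t and 2t: it is 0 for s <= t, s - t for
    t <= s <= 2t, and t for s >= 2t. As a difference of minima it telescopes. *)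
Definition slab t s := Num.min s (2 * t) - Num.min s t.

Lemma slab_nondecreasing t : 0 <= t -> {homo slab t : a b / a <= b}.
Proof.
move=> t0 a b ab; rewrite /slab.
by case: (leP a (2 * t)); case: (leP a t); case: (leP b (2 * t));
  case: (leP b t); lra.
Qed.

Lemma slab_contraction t a b : 0 <= t -> `|slab t b - slab t a| <= `|b - a|.
Proof.
move=> t0; wlog ab : a b / a <= b => [th|].
  by have [/th//|/ltW/th] := leP a b; rewrite distrC [leRHS]distrC.
rewrite !ger0_norm ?subr_ge0 ?slab_nondecreasing// /slab.
by case: (leP a (2 * t)); case: (leP a t); case: (leP b (2 * t));
  case: (leP b t); lra.
Qed.

Lemma slab_eq0 t s : 0 <= t -> s <= t -> slab t s = 0.
Proof. by rewrite /slab; case: (leP s (2 * t)); case: (leP s t); lra. Qed.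

Lemma slab_eq t s : 0 <= t -> 2 * t <= s -> slab t s = t.
Proof. by rewrite /slab; case: (leP s (2 * t)); case: (leP s t); lra. Qed.

Lemma sum_slab eps s K : \sum_(k < K) slab (eps * 2 ^+ k) s =
  Num.min s (eps * 2 ^+ K) - Num.min s eps.
Proof.
elim: K => [|K ih]; first by rewrite big_ord0 mulr1 subrr.
by rewrite big_ord_recr/= ih /slab exprS mulrCA; ring.
Qed.

(** The slab functions are nondecreasing and their sum, a difference of two minima,
    is 1-Lipschitz; hence the increments have a common sign and total at most
    |b - a|, and powR_sum_ge applies. *)
Lemma sum_slab_powR_le p eps a b K : 1 <= p -> 0 <= eps ->
  \sum_(k < K) `|slab (eps * 2 ^+ k) b - slab (eps * 2 ^+ k) a| `^ p
    <= `|b - a| `^ p.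
Proof.
move=> p1 e0; wlog ab : a b / a <= b => [th|].
  have [/th//|/ltW/th] := leP a b.
  rewrite distrC; under eq_bigr do rewrite distrC.
  by [].
have t0 k : 0 <= eps * 2 ^+ k by rewrite mulr_ge0// exprn_ge0.
under eq_bigr do rewrite ger0_norm ?subr_ge0 ?slab_nondecreasing//.
rewrite (le_trans (powR_sum_ge _ p1 _))//.
  by move=> k; rewrite subr_ge0 slab_nondecreasing.
rewrite ler_powRl ?(le_trans _ p1)//.
  by rewrite sumr_ge0// => k _; rewrite subr_ge0 slab_nondecreasing.
rewrite sumrB !sum_slab ger0_norm ?subr_ge0//.
have : eps <= eps * 2 ^+ K by rewrite ler_peMr// exprn_ege1// ler1n.
set T := eps * _ => ?.
by case: (leP a T); case: (leP a eps); case: (leP b T); case: (leP b eps); lra.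
Qed.

End Powers.

(** * Words and balls *)

Section Words.
Variable G : groupType.
Implicit Types (S : set G) (x : G) (n : nat).

(** The elements that are words form a subgroup; symmetry of S gives inverses. *)
Lemma generates_word S : generates S -> symmetric_set S ->
  forall x, exists w, is_word S w x.
Proof.
move=> genS symS x.
pose H : set G := [set x | exists w, is_word S w x].
have HM y z : H y -> H z -> H (y * z)%g.
  move=> [v [vS ->]] [w [wS ->]]; exists (v ++ w); split; last by rewrite big_cat.
  by move=> s; rewrite mem_cat => /orP[/vS|/wS].
have H1 : H 1%g by exists [::]; split => //; rewrite big_nil.
have SH : S `<=` H.
  move=> s Ss; exists [:: s]; split; last by rewrite big_seq1.
  by move=> t; rewrite inE => /eqP ->.
have HV y : H y -> H y^-1%g.
  move=> [w [wS ->]]; elim: w wS => [|s w ih] wS; first by rewrite big_nil invg1.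
  rewrite big_cons invgM; apply: HM.
    by apply: ih => t tw; apply: wS; rewrite inE tw orbT.
  by apply: SH; rewrite -symS; exists s => //; apply: wS; rewrite inE eqxx.
have : smallest (@is_subgroup G) S x by rewrite genS.
by move=> /(_ H); apply; split => //; split.
Qed.

Lemma word_length_le S x n : generates S -> symmetric_set S ->
  (word_length S x <= n)%N -> exists2 w, is_word S w x & (size w <= n)%N.
Proof.
move=> genS symS; rewrite /word_length; case: pselect => [exn|noword _].
  by case: ex_minnP => m /asboolP[w ww <-] _ le; exists w.
have [w ww] := generates_word genS symS x.
by case: noword; exists (size w); apply/asboolP; exists w.
Qed.

(** An infinite ball has growth 0 by convention, and the empty list is then a
    witness. *)
Lemma growth_ball S n : generates S -> symmetric_set S ->
  exists B : seq G, [/\ uniq B, size B = growth S n &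
    {in B, forall g, exists2 w, is_word S w g & (size w <= n)%N}].
Proof.
move=> genS symS; rewrite /growth; set A := [set x | _].
exists (fset_set A); split=> [||g]; [exact: fset_uniq | by [] |].
have [Afin|Ainf] := pselect (finite_set A); last by rewrite /fset_set; case: pselect.
rewrite in_fset_set// inE /A/= /word_dist invg1 mul1g.
exact: word_length_le.
Qed.

End Words.

(** * The energy and translations *)

Section Energy.
Variables (R : realType) (G : groupType) (S : set G).
Implicit Types (p A t : R) (f h u v : G -> R) (X Y B : seq G).

(** A directed edge is encoded as its origin and the generator that labels it, so
    that right translations act on edges. *)
Definition edge_pow p f (e : G * G) : R := `|f (e.1 * e.2)%g - f e.1| `^ p.

Definition energy p f : \bar R :=
  (\esum_(e in [set: G] `*` S) (edge_pow p f e)%:E)%E.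

Lemma edge_pow_ge0 p f e : 0 <= edge_pow p f e.
Proof. exact: powR_ge0. Qed.

Lemma energy_ge0 p f : (0 <= energy p f)%E.
Proof. by apply: esum_ge0 => e _; rewrite lee_fin edge_pow_ge0. Qed.

Lemma D1p_normE p f : D1p_norm S p f = (energy p f `^ p^-1)%E.
Proof.
rewrite /D1p_norm /energy; congr (_ `^ _)%E.
rewrite (_ : [set: G] `*` S = [set: G] `*`` (fun=> S)); last first.
  by apply/seteqP; split.
rewrite -(@esum_esum _ _ _ setT (fun=> S)
    (fun x s => (edge_pow p f (x, s))%:E)); last first.
  by move=> *; rewrite lee_fin edge_pow_ge0.
apply: eq_esum => x _.
rewrite (_ : [set y | _] = [set (x * s)%g | s in S]); last first.
  by apply/seteqP; split=> y [s Ss ys]; exists s.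
rewrite (esum_image S (fun s => x * s)%g)//.
by move=> s t _ _; exact: mulgI.
Qed.

Lemma D1p_norm_lty p f : 0 < p -> (D1p_norm S p f < +oo)%E <-> (energy p f < +oo)%E.
Proof.
move=> p0; rewrite D1p_normE; split; last exact: poweR_lty.
by apply: lty_poweRy; rewrite invr_eq0 gt_eqF.
Qed.

Lemma energy_le_powR p f t : 0 < p -> 0 <= t ->
  (D1p_norm S p f <= t%:E)%E <-> (energy p f <= (t `^ p)%:E)%E.
Proof.
move=> p0 t0; rewrite D1p_normE.
have := energy_ge0 p f; case: (energy p f) => [a| |]//=; last first.
  by rewrite invr_eq0 gt_eqF.
rewrite !lee_fin => a0; split=> le.
  rewrite -[a]powRr1// -(mulVf (lt0r_neq0 p0)) powRrM.
  by rewrite ler_powRl ?powR_ge0// ltW.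
rewrite -[t]powRr1// -(mulfV (lt0r_neq0 p0)) powRrM.
by rewrite ler_powRl// invr_ge0 ltW.
Qed.

Lemma energy_leP p f A : (energy p f <= A%:E)%E <->
  forall r, uniq r -> {in r, forall e, S e.2} ->
    \sum_(e <- r) edge_pow p f e <= A.
Proof.
rewrite /energy esum_le_finP => [|e _]; last exact: edge_pow_ge0.
split=> le r ur rS; apply: le => // e er; last by have [] := rS e er.
by split=> //; exact: rS.
Qed.

Lemma energy_step p f A s X : (energy p f <= A%:E)%E -> S s -> uniq X ->
  \sum_(x <- X) `|f (x * s)%g - f x| `^ p <= A.
Proof.
move=> /energy_leP le Ss uX.
have := le [seq (x, s) | x <- X]; rewrite big_map; apply.
  by rewrite map_inj_uniq// => x y [].
by move=> _ /mapP[x _ ->].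
Qed.

(** Induction on the word: peel off the first letter s, compare x with xs by one
    layer of edges, and reindex the remaining translation along x |-> xs. The
    weights n and 1 in powRD_weighted_le turn n^p A and A into (n + 1)^p A. *)
Lemma energy_translate p f A w X : 1 <= p -> (energy p f <= A%:E)%E ->
    {in w, forall s, S s} -> uniq X ->
  \sum_(x <- X) `|f (x * \big[*%g/1%g]_(s <- w) s)%g - f x| `^ p <=
    (size w)%:R `^ p * A.
Proof.
move=> p1 fA; have p0 : 0 < p by rewrite (lt_le_trans _ p1).
elim: w X => [|s w ih] X wS uX.
  rewrite big1 ?powR0 ?mul0r ?gt_eqF// => x _.
  by rewrite big_nil mulg1 subrr normr0 powR0 ?gt_eqF.
have Ss : S s by apply: wS; rewrite inE eqxx.
have {}wS : {in w, forall s, S s} by move=> t tw; apply: wS; rewrite inE tw orbT.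
have step := energy_step fA Ss uX.
(* The weight n must be positive, so the one-letter word is treated apart. *)
have [w0|wpos] := posnP (size w).
  by rewrite (size0nil w0)/= powR1 mul1r; under eq_bigr do rewrite big_seq1.
set g := \big[*%g/1%g]_(s <- w) s in ih *.
set n := size w in wpos *.
have n0 : 0 < n%:R :> R by rewrite ltr0n.
have le x : `|f (x * \big[*%g/1%g]_(s0 <- s :: w) s0)%g - f x| `^ p <=
  (n%:R + 1) `^ (p - 1) * (`|f (x * s * g)%g - f (x * s)%g| `^ p / n%:R `^ (p - 1)
     + `|f (x * s)%g - f x| `^ p / 1 `^ (p - 1)).
  apply: le_trans (powRD_weighted_le p1 (normr_ge0 _) (normr_ge0 _) n0 ltr01).
  rewrite ler_powRl ?(ltW p0)//.
  by rewrite big_cons mulgA (le_trans _ (ler_normD _ _))// addrA subrK.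
rewrite (le_trans (ler_sum _ (fun x _ => le x)))//.
rewrite -mulr_sumr big_split/= -!mulr_suml powR1 invr1 mulr1.
have /ih : uniq [seq (x * s)%g | x <- X] by rewrite map_inj_uniq//; exact: mulIg.
rewrite big_map => /(_ wS) le2.
rewrite -natr1 -/n; rewrite -/n in le2.
rewrite -(mulr_powRB1 (addr_ge0 (ltW n0) ler01) p0).
rewrite [leRHS](_ : _ = (n%:R + 1) `^ (p - 1) * (n%:R * A + A)); last by ring.
rewrite ler_wpM2l ?powR_ge0// lerD// ler_pdivrMr ?powR_gt0//.
by rewrite (le_trans le2)// -(mulr_powRB1 (ltW n0) p0) mulrAC.
Qed.

(** For x in X, the map g |-> xg is injective, so at most |Y| of the elements g of
    B keep xg inside Y; the others, at least half of B, satisfy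
    |h(xg) - h(x)| = |t|. Summing over X and B and exchanging the sums, each g
    contributes at most n^p A by energy_translate. *)
Lemma plateau_le p h A t (n : nat) X Y B : 1 <= p -> (energy p h <= A%:E)%E ->
    uniq X -> {in X, forall x, h x = t} ->
    (forall x, x \notin Y -> h x = 0) ->
    uniq B -> {in B, forall g, exists2 w, is_word S w g & (size w <= n)%N} ->
    (0 < size B)%N -> (2 * size Y <= size B)%N ->
  (size X)%:R * `|t| `^ p <= 2 * n%:R `^ p * A.
Proof.
move=> p1 hA uX hX hY uB wordB B0 YB; have p0 : 0 < p by rewrite (lt_le_trans _ p1).
have A0 : 0 <= A by rewrite -lee_fin (le_trans (energy_ge0 _ _) hA).
have B0' : 0 < (size B)%:R :> R by rewrite ltr0n.
have up : \sum_(x <- X) \sum_(g <- B) `|h (x * g)%g - h x| `^ p <=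
    (size B)%:R * (n%:R `^ p * A).
  rewrite exchange_big/= mulr_natl -sum1_size -sumrMnr.
  rewrite big_seq [leRHS]big_seq ler_sum// => g /wordB[w [wS ->] wn].
  rewrite mulr1n (le_trans (energy_translate p1 hA wS uX))//.
  by rewrite ler_wpM2r// ler_powRl ?ler_nat// ltW.
have low x : x \in X ->
    (size B)%:R / 2 * `|t| `^ p <= \sum_(g <- B) `|h (x * g)%g - h x| `^ p.
  (* out g says that translating x by g leaves Y, where h vanishes. *)
  move=> xX; pose out (g : G) := (x * g)%g \notin Y.
  have inY : (count (predC out) B <= size Y)%N.
    rewrite -size_filter -(size_map (fun g => x * g)%g); apply: uniq_leq_size.
      by rewrite map_inj_uniq ?filter_uniq//; exact: mulgI.
    by move=> _ /mapP[g + ->]; rewrite mem_filter/= negbK => /andP[].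
  rewrite (bigID out)/= ler_wpDr ?sumr_ge0//.
  rewrite (eq_bigr (fun=> `|t| `^ p)) => [|g /hY ->]; last first.
    by rewrite hX// sub0r normrN.
  rewrite big_const_seq iter_addr_0 -[leRHS]mulr_natl ler_wpM2r ?powR_ge0//.
  rewrite ler_pdivrMr// -natrM ler_nat.
  move: (count_predC out B) inY YB; lia.
have {up} : (size X)%:R * ((size B)%:R / 2 * `|t| `^ p) <=
    (size B)%:R * (n%:R `^ p * A).
  apply: le_trans up; rewrite mulr_natl -(sum1_size X) -sumrMnr.
  by rewrite big_seq [leRHS]big_seq ler_sum// => x /low; rewrite mulr1n.
rewrite [leLHS](_ : _ = (size B)%:R * ((size X)%:R * `|t| `^ p / 2)); last by ring.
rewrite ler_pM2l// ler_pdivrMr// => /le_trans; apply.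
by rewrite le_eqVlt; apply/orP; left; apply/eqP; ring.
Qed.

End Energy.

(** * Dyadic summation *)

Section Dyadic.
Variable R : realType.
Implicit Types (a E b : nat -> R) (p q D A eps s th : R).

(** The relation q(1 - th) = p makes the powers of eps 2^k cancel when the
    hypothesis is rewritten for b_k = (eps 2^k)^q a_k, giving
    b_{k+1} <= 2^q D b_k^th E_k. Bounding each b_k^th by the th-th power of the
    whole sum B yields B <= b_0 + 2^q D A B^th: either b_0 is at least B/2, or it
    can be absorbed and B^(1 - th) is bounded. *)
Lemma dyadic_sum_le a E p q th D A eps (K : nat) :
    0 < eps -> 0 < q -> th < 1 -> q * (1 - th) = p -> 0 <= th -> 0 <= D ->
    (forall k, 0 <= a k) -> (forall k, 0 <= E k) ->
    (forall k, a k.+1 * (eps * 2 ^+ k) `^ p <= D * a k `^ th * E k) ->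
    \sum_(k < K) E k <= A ->
  \sum_(k < K) (eps * 2 ^+ k) `^ q * a k <=
    2 * (eps `^ q * a 0%N) + (2 * 2 `^ q * D * A) `^ (1 - th)^-1.
Proof.
move=> e0 q0 th1 qth th0 D0 a0 E0 step EA.
have A0 : 0 <= A by rewrite (le_trans _ EA)// sumr_ge0.
pose t k := eps * 2 ^+ k; pose b k := t k `^ q * a k.
have t0 k : 0 < t k by rewrite mulr_gt0// exprn_gt0.
have b0 k : 0 <= b k by rewrite mulr_ge0// powR_ge0.
have bstep k : b k.+1 <= 2 `^ q * D * b k `^ th * E k.
  have -> : b k.+1 = 2 `^ q * (t k `^ (q * th)) * (a k.+1 * t k `^ p).
    rewrite /b (_ : t k.+1 = 2 * t k); last by rewrite /t exprS; ring.
    have tq : t k `^ q = t k `^ (q * th) * t k `^ p.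
      by rewrite -powRD ?(gt_eqF (t0 k)) ?implybT// -qth; congr (powR _); ring.
    rewrite powRM ?ltW// tq; ring.
  have -> : b k `^ th = t k `^ (q * th) * a k `^ th.
    by rewrite powRM ?powR_ge0// powRrM.
  rewrite [leRHS](_ : _ = 2 `^ q * t k `^ (q * th) * (D * a k `^ th * E k)).
    by rewrite ler_wpM2l ?mulr_ge0 ?powR_ge0//; exact: step.
  by ring.
set B := \sum_(k < K) _; have B0 : 0 <= B by rewrite sumr_ge0// => k _; exact: b0.
have bB (k : 'I_K) : b k <= B.
  by rewrite /B (bigD1 k)//= lerDl sumr_ge0// => i _; exact: b0.
have : B <= b 0%N + 2 `^ q * D * B `^ th * A.
  have le1 : B <= \sum_(k < K.+1) b k by rewrite big_ord_recr/= lerDl.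
  rewrite (le_trans le1)// big_ord_recl/= lerD2l.
  rewrite (@le_trans _ _ (\sum_(k < K) 2 `^ q * D * B `^ th * E k))//.
    apply: ler_sum => k _; rewrite (le_trans (bstep k))// ler_wpM2r//.
    by rewrite ler_wpM2l ?mulr_ge0 ?powR_ge0// ler_powRl.
  by rewrite -mulr_sumr ler_wpM2l ?mulr_ge0 ?powR_ge0.
have -> : eps `^ q * a 0%N = b 0%N by rewrite /b /t mulr1.
(* Either the starting term dominates, or it is absorbed into B. *)
have [le _|lt le] := leP B (2 * b 0%N).
  by rewrite (le_trans le)// lerDl powR_ge0.
apply: (@le_trans _ _ ((2 * 2 `^ q * D * A) `^ (1 - th)^-1)); last first.
  by rewrite lerDr mulr_ge0.
have Bpos : 0 < B by rewrite (le_lt_trans _ lt)// mulr_ge0.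
have th' : 1 - th != 0 by rewrite subr_eq0 gt_eqF.
have -> : B = (B `^ (1 - th)) `^ (1 - th)^-1 by rewrite -powRrM mulfV// powRr1.
rewrite ler_powRl ?powR_ge0//.
  by rewrite invr_ge0 subr_ge0 ltW.
rewrite -(@ler_pM2r _ (B `^ th)) ?powR_gt0//.
rewrite -powRD ?(gt_eqF Bpos) ?implybT// subrK powRr1//.
have : B <= 2 * (2 `^ q * D * B `^ th * A) by lra.
by move=> /le_trans; apply; rewrite le_eqVlt; apply/orP; left; apply/eqP; ring.
Qed.

(** If eps 2^k <= s < eps 2^(k+1), the k-th term alone bounds s^q. *)
Lemma dyadic_powR_le q eps s (K : nat) : 0 < q -> 0 < eps -> 0 <= s ->
  s < eps * 2 ^+ K ->
  s `^ q <= eps `^ q +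
    2 `^ q * \sum_(k < K) (eps * 2 ^+ k) `^ q * (eps * 2 ^+ k <= s)%R%:R.
Proof.
move=> q0 e0 s0; elim: K => [|K ih] sK.
  rewrite expr0 mulr1 in sK.
  by rewrite big_ord0 mulr0 addr0 ler_powRl// ltW.
have [/ih le|le] := ltP s (eps * 2 ^+ K).
  rewrite (le_trans le)// lerD2l ler_wpM2l ?powR_ge0// big_ord_recr/=.
  by rewrite lerDl mulr_ge0 ?powR_ge0.
rewrite (@le_trans _ _ (2 `^ q * (eps * 2 ^+ K) `^ q))//.
  rewrite -powRM ?mulr_ge0 ?exprn_ge0 ?(ltW e0)// ler_powRl ?(ltW q0)//.
  by rewrite mulrCA -exprS ltW.
rewrite big_ord_recr/= le mulr1 mulrDr addrA lerDr addr_ge0 ?powR_ge0//.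
by rewrite mulr_ge0 ?powR_ge0// sumr_ge0// => k _; rewrite mulr_ge0 ?powR_ge0.
Qed.

Lemma sum_le_support (T : choiceType) (r F : seq T) (a : T -> R) :
  uniq r -> uniq F -> (forall x, 0 <= a x) ->
    {in r, forall x, x \notin F -> a x = 0} ->
  \sum_(x <- r) a x <= \sum_(x <- F) a x.
Proof.
move=> ur uF a0 aF.
rewrite (bigID (mem F))/= [X in _ + X]big1_seq ?addr0; last first.
  by move=> x /andP[xF xr]; exact: aF.
rewrite -big_filter (perm_big [seq x <- F | x \in r]).
  by rewrite big_filter [leRHS](bigID (mem r))/= lerDl sumr_ge0.
apply: uniq_perm; rewrite ?filter_uniq// => x.
by rewrite !mem_filter andbC.
Qed.

End Dyadic.

(** * The Sobolev inequality *)

Section Sobolev.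
Variables (R : realType) (G : groupType) (S : set G).
Hypotheses (genS : generates S) (symS : symmetric_set S).
Implicit Types (p A t : R) (f h u v : G -> R) (X Y F : seq G).

(** Apply plateau_le with a radius n just large enough for the growth bound to give
    the ball 2|Y| elements: n is of order |Y|^(1/N), the rounding error 1 being
    absorbed because |Y| >= 1. *)
Lemma plateau_capacity_le (N : nat) p (C1 : R) : (0 < N)%N -> 1 <= p -> 0 < C1 ->
    (forall n, (1 <= n)%N -> C1 * n%:R ^+ N <= (growth S n)%:R) ->
  exists2 D, 0 <= D & forall h X Y t A, 0 < t -> (energy S p h <= A%:E)%E ->
    uniq X -> {in X, forall x, h x = t} -> (forall x, x \notin Y -> h x = 0) ->
    (size X)%:R * t `^ p <= D * (size Y)%:R `^ (p / N%:R) * A.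
Proof.
move=> N0 p1 C0 gr; have p0 : 0 < p by rewrite (lt_le_trans _ p1).
(* Chosen so that C1 (c |Y|^(1/N))^N = 2 |Y|. *)
pose c := (2 / C1) `^ N%:R^-1.
have c0 : 0 <= c by exact: powR_ge0.
exists (2 * (c + 1) `^ p); first by rewrite mulr_ge0 ?powR_ge0.
move=> h X Y t A t0 hA uX hX hY.
have A0 : 0 <= A by rewrite -lee_fin (le_trans (energy_ge0 _ _ _) hA).
have [Y0|Ypos] := posnP (size Y).
  have -> : X = [::].
    case: X {uX} hX => // x X /(_ x); rewrite inE eqxx => /(_ isT).
    by rewrite hY ?(size0nil Y0)// => t_eq0; rewrite -t_eq0 ltxx in t0.
  by rewrite mul0r !mulr_ge0 ?powR_ge0.
have Y1 : 1 <= (size Y)%:R :> R by rewrite ler1n.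
pose m := c * (size Y)%:R `^ N%:R^-1.
have m0 : 0 <= m by rewrite mulr_ge0 ?powR_ge0.
pose n := (Num.trunc m).+1.
have mn : m <= n%:R by rewrite ltW// truncnS_gt.
have nm : n%:R <= m + 1 by rewrite -natr1 lerD2r truncn_le.
have [B [uB sB wB]] := growth_ball n genS symS.
have YB : (2 * size Y <= size B)%N.
  rewrite sB -(ler_nat R) (le_trans _ (gr n _))//.
  rewrite (@le_trans _ _ (C1 * m ^+ N))//; last first.
    by rewrite ler_pM2l// lerXn2r ?nnegrE.
  rewrite /m exprMn -!powR_mulrn ?powR_ge0// -!powRrM mulVf ?pnatr_eq0 -?lt0n//.
  rewrite !powRr1 ?divr_ge0 ?(ltW C0)// natrM le_eqVlt; apply/orP; left; apply/eqP.
  by field; rewrite gt_eqF.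
have B0 : (0 < size B)%N by rewrite (leq_trans _ YB)// muln_gt0.
have := plateau_le p1 hA uX hX hY uB wB B0 YB.
rewrite (gtr0_norm t0) => le; apply: le_trans le _.
rewrite ler_wpM2r// -mulrA ler_wpM2l// mulrC powRrM.
rewrite powRAC -powRM ?powR_ge0 ?addr_ge0// ler_powRl ?(ltW p0)//.
rewrite (le_trans nm)// /m mulrDr mulr1 mulrC lerD2l.
have Ni : 0 <= N%:R^-1 :> R by rewrite invr_ge0.
by have := ler_powRl Ni ler01 Y1; rewrite powR1.
Qed.

Lemma energy_le_contraction p f h : 0 <= p ->
  (forall x y, `|h y - h x| <= `|f y - f x|) -> (energy S p h <= energy S p f)%E.
Proof.
move=> p0 le; apply: le_esum => e _; rewrite lee_fin /edge_pow ler_powRl//.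
Qed.

Lemma sum_energy_slab_le p f (eps : R) (K : nat) : 1 <= p -> 0 <= eps ->
  (\sum_(k < K) energy S p (slab (eps * 2 ^+ k) \o f) <= energy S p f)%E.
Proof.
move=> p1 e0; rewrite -esum_sum => [|e k _ _]; last by rewrite lee_fin edge_pow_ge0.
apply: le_esum => e _; rewrite sumEFin lee_fin /edge_pow/=.
exact: sum_slab_powR_le.
Qed.

(** The slabs of f at heights eps 2^k feed plateau_capacity_le into dyadic_sum_le.
    Points where f < eps and the starting term of the dyadic sum contribute a
    multiple of |F| eps^q, which disappears as eps tends to 0. *)
Lemma sobolev_nonneg (N : nat) p (C1 : R) : 1 <= p -> p < N%:R -> 0 < C1 ->
    (forall n, (1 <= n)%N -> C1 * n%:R ^+ N <= (growth S n)%:R) ->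
  exists2 C, 0 <= C & forall f F A, (forall x, 0 <= f x) -> uniq F ->
    (forall x, x \notin F -> f x = 0) -> (energy S p f <= A%:E)%E ->
    \sum_(x <- F) f x `^ (N%:R * p / (N%:R - p)) <=
      C * A `^ (N%:R / (N%:R - p)).
Proof.
move=> p1 pN C0 gr; have p0 : 0 < p by rewrite (lt_le_trans _ p1).
have NR0 : 0 < N%:R :> R by rewrite (lt_trans p0).
have N0 : (0 < N)%N by rewrite -(ltr0n R).
have Np : 0 < N%:R - p by rewrite subr_gt0.
have [D D0 cap] := plateau_capacity_le N0 p1 C0 gr.
set q := N%:R * p / (N%:R - p); pose th := p / N%:R.
have q0 : 0 < q by rewrite divr_gt0// mulr_gt0.
have th0 : 0 <= th by rewrite divr_ge0// ltW.
have th1 : th < 1 by rewrite ltr_pdivrMr// mul1r.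
have thE : (1 - th)^-1 = N%:R / (N%:R - p).
  by rewrite /th; field; rewrite !gt_eqF.
have qth : q * (1 - th) = p by rewrite /q /th; field; rewrite !gt_eqF.
rewrite -thE; exists (2 `^ q * (2 * 2 `^ q * D) `^ (1 - th)^-1).
  by rewrite mulr_ge0 ?powR_ge0.
move=> f F A f0 uF fF fA.
have A0 : 0 <= A by rewrite -lee_fin (le_trans (energy_ge0 _ _ _) fA).
set M := (2 * 2 `^ q * D) `^ (1 - th)^-1.
have MA : (2 * 2 `^ q * D * A) `^ (1 - th)^-1 = M * A `^ (1 - th)^-1.
  by rewrite powRM// !mulr_ge0 ?powR_ge0.
set n : R := (size F)%:R.
have main eps : 0 < eps -> \sum_(x <- F) f x `^ q <=
    (1 + 2 * 2 `^ q) * n * eps `^ q + 2 `^ q * (M * A `^ (1 - th)^-1).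
  move=> e0; pose t k := eps * 2 ^+ k.
  have t0 k : 0 < t k by rewrite mulr_gt0// exprn_gt0.
  (* A height above all values of f, where the slabs stop. *)
  have [K fK] : exists K, {in F, forall x, f x < t K}.
    pose K := (Num.trunc (\sum_(x <- F) f x / eps)).+1; exists K => x xF.
    rewrite /t mulrC -ltr_pdivrMr//.
    apply: (@le_lt_trans _ _ (\sum_(x <- F) f x / eps)).
      rewrite (bigD1_seq x)//= lerDl sumr_ge0// => y _.
      by rewrite divr_ge0// ltW.
    apply: lt_trans (truncnS_gt _) _; rewrite -natrX ltr_nat.
    exact: ltn_expl.
  pose Y k := [seq x <- F | t k <= f x].
  pose a k : R := (size (Y k))%:R.
  have aE k : a k = \sum_(x <- F) (t k <= f x)%R%:R.
    rewrite /a size_filter -sum1_count natr_sum big_mkcond/=.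
    by apply: eq_bigr => x _; case: ifP.
  have sE := sum_energy_slab_le f K p1 (ltW e0).
  have fin k : energy S p (slab (t k) \o f) \is a fin_num.
    rewrite ge0_fin_numE ?energy_ge0// (le_lt_trans _ (ltry A))//.
    apply: le_trans fA; apply: energy_le_contraction (ltW p0) _ => x y /=.
    exact/slab_contraction/ltW.
  pose E k := fine (energy S p (slab (t k) \o f)).
  have EA : \sum_(k < K) E k <= A.
    rewrite -lee_fin -sumEFin (le_trans _ fA)// (le_trans _ sE)//.
    by apply: lee_sum => k _; rewrite fineK.
  have E0 k : 0 <= E k by rewrite fine_ge0 ?energy_ge0.
  have step k : a k.+1 * t k `^ p <= D * a k `^ th * E k.
    apply: cap (t0 k) _ (filter_uniq _ uF) _ _.
    - by rewrite fineK.
    - move=> x; rewrite mem_filter /= => /andP[le _].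
      by rewrite slab_eq ?(ltW (t0 k))// mulrCA -exprS.
    - move=> x; rewrite mem_filter negb_and /= -ltNge => /orP[/ltW le|/fF ->].
        by rewrite slab_eq0// ltW.
      by rewrite slab_eq0// ltW.
  have B := dyadic_sum_le e0 q0 th1 qth th0 D0 (fun k => ler0n _ _) E0 step EA.
  have an k : a k <= n by rewrite ler_nat size_filter count_size.
  rewrite (@le_trans _ _ (n * eps `^ q + 2 `^ q * \sum_(k < K) t k `^ q * a k))//.
    rewrite (@le_trans _ _ (\sum_(x <- F) (eps `^ q +
       2 `^ q * \sum_(k < K) t k `^ q * (t k <= f x)%R%:R)))//.
      rewrite big_seq [leRHS]big_seq ler_sum// => x xF.
      by apply: dyadic_powR_le => //; exact: fK.
    rewrite big_split/= -mulr_sumr exchange_big/= lerD//.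
      by rewrite big_const_seq count_predT iter_addr_0 mulr_natl.
    rewrite ler_wpM2l ?powR_ge0// ler_sum// => k _.
    by rewrite -mulr_sumr -aE.
  rewrite mulrDl mul1r mulrDl -addrA lerD2l.
  rewrite (@le_trans _ _ (2 `^ q * (2 * (eps `^ q * n) + M * A `^ (1 - th)^-1)))//.
    rewrite ler_wpM2l ?powR_ge0// -MA (le_trans B)// lerD2r ler_wpM2l//.
    by rewrite ler_wpM2l ?powR_ge0//; exact: an.
  by rewrite le_eqVlt; apply/orP; left; apply/eqP; ring.
rewrite -mulrA; apply/ler_addgt0Pl => d d0.
(* eps is chosen so that the error term of main is at most d. *)
pose c := (1 + 2 * 2 `^ q) * n + 1.
have cn : 0 <= (1 + 2 * 2 `^ q) * n.
  by rewrite mulr_ge0// addr_ge0// mulr_ge0// powR_ge0.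
have c0 : 0 < c by rewrite ltr_wpDl.
have dc : 0 < d / c by rewrite divr_gt0.
rewrite (le_trans (main ((d / c) `^ q^-1) _)) ?powR_gt0// lerD2r.
rewrite -powRrM mulVf ?gt_eqF// powRr1 ?(ltW dc)//.
by rewrite mulrA ler_pdivrMr// mulrC ler_pM2l// lerDl.
Qed.

Lemma sobolev (N : nat) p (C1 : R) : 1 <= p -> p < N%:R -> 0 < C1 ->
    (forall n, (1 <= n)%N -> C1 * n%:R ^+ N <= (growth S n)%:R) ->
  exists2 C, 0 <= C & forall f A, finitely_supported f ->
    (energy S p f <= A%:E)%E ->
    (\esum_(x in [set: G]) (`|f x| `^ (N%:R * p / (N%:R - p)))%:E <=
      (C * A `^ (N%:R / (N%:R - p)))%:E)%E.
Proof.
move=> p1 pN C0 gr; have [C C'0 le] := sobolev_nonneg p1 pN C0 gr.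
exists C => // f A finf fA; have p0 : 0 < p by rewrite (lt_le_trans _ p1).
pose F := fset_set [set x | f x != 0].
have fF x : x \notin F -> f x = 0.
  by rewrite in_fset_set// notin_setE/= => /negP; rewrite negbK => /eqP.
have absA : (energy S p (fun x => `|f x|%R) <= A%:E)%E.
  apply: le_trans fA; apply: energy_le_contraction (ltW p0) _ => x y.
  exact: ler_dist_dist.
apply/esum_le_finP => [x _|r ur _]; first exact: powR_ge0.
have absF x : x \notin F -> `|f x| = 0 by move=> /fF ->; rewrite normr0.
apply: le_trans (le _ F _ _ _ absF absA); rewrite ?fset_uniq//.
have q0 : 0 < N%:R * p / (N%:R - p).
  by rewrite divr_gt0 ?subr_gt0// mulr_gt0// (lt_trans p0).
apply: sum_le_support => // x _ /absF ->.
by rewrite powR0// gt_eqF.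
Qed.

End Sobolev.

(** * Pointwise limits and domination *)

Section Limits.
Variables (R : realType) (T : choiceType).
Implicit Types (I : set T) (a : T -> R).

Lemma continuous_powR (p b : R) : 0 < p -> 0 < b ->
  {for b, continuous (@powR R ^~ p)}.
Proof.
move=> p0 b0; apply: differentiable_continuous; apply/derivable1_diffP.
by apply: derivable_powR; rewrite in_itv/= b0.
Qed.

(** The power is differentiable away from 0; at 0 a direct estimate is needed. *)
Lemma cvg_norm_powR (p : R) (a : nat -> R) (l : R) : 0 < p ->
  a n @[n --> \oo] --> l -> `|a n| `^ p @[n --> \oo] --> `|l| `^ p.
Proof.
move=> p0 al; have [l_eq0|l0] := eqVneq l 0; last first.
  apply: (@continuous_cvg _ _ _ _ _ (fun n => `|a n|) (@powR R ^~ p)).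
    by apply: continuous_powR => //; rewrite normr_gt0.
  exact: cvg_norm.
rewrite l_eq0 normr0 powR0 ?gt_eqF//; apply/cvgrPdist_lt => e e0.
near=> n; rewrite sub0r normrN ger0_norm ?powR_ge0//.
have -> : e = (e `^ p^-1) `^ p by rewrite -powRrM mulVf ?gt_eqF// powRr1// ltW.
rewrite gt0_ltr_powR ?nnegrE ?powR_ge0//.
near: n; have /cvgrPdist_lt/(_ (e `^ p^-1)) := al; rewrite powR_gt0// => /(_ isT).
by apply: filterS => n; rewrite l_eq0 sub0r normrN.
Unshelve. all: by end_near. Qed.

(** Fatou: finite sums commute with limits. *)
Lemma esum_lim_le I (h : nat -> T -> R) a (M : R) (K : nat) :
    (forall n i, 0 <= h n i) -> (forall i, h n i @[n --> \oo] --> a i) ->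
    (forall n, (K <= n)%N -> (\esum_(i in I) (h n i)%:E <= M%:E)%E) ->
  (\esum_(i in I) (a i)%:E <= M%:E)%E.
Proof.
move=> h0 ha hM; have a0 i : 0 <= a i.
  by apply: cvgr_to_ge (ha i) _; exact: nearW.
apply/esum_le_finP => // r ur rI.
apply: (@cvgr_to_le _ \oo _ _ (fun n => \sum_(i <- r) h n i)).
  by apply: cvg_big => //; exact: add_continuous.
near=> n; have : (\esum_(i in I) (h n i)%:E <= M%:E)%E.
  by apply: hM; near: n; exists K.
by move=> /(esum_le_finP _ (fun i _ => h0 n i)); apply.
Unshelve. all: by end_near. Qed.

Lemma esum_superlevel_finite I a (c : R) : (forall i, I i -> 0 <= a i) ->
  (\esum_(i in I) (a i)%:E < +oo)%E -> 0 < c ->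
  finite_set [set i | I i /\ c <= a i].
Proof.
move=> a0 /(esum_ltyP a0)[M le] c0; apply: contrapT => infA.
have [B BA Bn] := infinite_set_fset (Num.trunc (M / c)).+1 infA.
have BI : {in (B : seq T), forall i, I i} by move=> i iB; have [] := BA i iB.
have := le B (fset_uniq B) BI; apply/negP; rewrite -ltNge.
apply: (@lt_le_trans _ _ (\sum_(i <- B) c)).
  rewrite big_const_seq count_predT iter_addr_0 -mulr_natr -ltr_pdivrMl// mulrC.
  by rewrite (lt_le_trans (truncnS_gt _))// ler_nat.
by rewrite big_seq [leRHS]big_seq ler_sum// => i iB; have [] := BA i iB.
Qed.

(** Dominated convergence in quantitative form: choose a finite set carrying all of
    the sum of a but d/2, and c so small that this finite set contributes at most
    d/2 to any g bounded by c. *)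
Lemma dominated_small_esum I a (d : R) : (forall i, 0 <= a i) ->
    (\esum_(i in I) (a i)%:E < +oo)%E -> 0 < d ->
  exists2 c : R, 0 < c & forall g, (forall i, 0 <= g i <= a i) ->
    (forall i, g i <= c) -> (\esum_(i in I) (g i)%:E <= d%:E)%E.
Proof.
move=> a0 fin d0; have d20 : 0 < d / 2 by rewrite divr_gt0.
have finE : \esum_(i in I) (a i)%:E \is a fin_num.
  by rewrite ge0_fin_numE// esum_ge0// => i _; rewrite lee_fin.
have [_ [X [finX XI] <-]] := ub_ereal_sup_adherent d20 finE.
rewrite -/(esum I _) -(fineK finE).
have /(esum_le_finP _ (fun i _ => a0 i)) : (\esum_(i in I) (a i)%:E <=
   (fine (\esum_(i in I) (a i)%:E))%:E)%E by rewrite fineK.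
set s := fine _ => le; rewrite fsbig_finite// sumEFin -EFinB lte_fin => lt.
set Y := fset_set X in lt.
have YI : {in (Y : seq T), forall i, I i} by move=> i; rewrite in_fset_set// inE => /XI.
pose n : R := (size Y)%:R.
have n1 : 0 < n + 1 by rewrite ltr_wpDl.
exists (d / 2 / (n + 1)); first by rewrite divr_gt0.
move=> g ga gc; apply/esum_le_finP => [i _|r ur rI]; first by case/andP: (ga i).
rewrite (bigID (mem Y))/=.
have in_le : \sum_(i <- r | i \in Y) g i <= d / 2.
  rewrite (@le_trans _ _ (\sum_(i <- r | i \in Y) d / 2 / (n + 1)))//.
    by rewrite ler_sum.
  rewrite big_const_seq iter_addr_0 -[leLHS]mulr_natr mulrAC ler_pdivrMr//.
  rewrite ler_pM2l// (@le_trans _ _ n)// ?lerDl// ler_nat -size_filter.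
  apply: uniq_leq_size; first exact: filter_uniq.
  by move=> i; rewrite mem_filter => /andP[].
have out_le : \sum_(i <- r | i \notin Y) g i <= d / 2.
  rewrite (@le_trans _ _ (\sum_(i <- r | i \notin Y) a i))//.
    by rewrite ler_sum// => i _; case/andP: (ga i).
  have : \sum_(i <- Y) a i + \sum_(i <- r | i \notin Y) a i <= s.
    have := le (Y ++ [seq i <- r | i \notin Y]); rewrite big_cat/= big_filter; apply.
      rewrite cat_uniq fset_uniq filter_uniq// andbT/=.
      by apply/hasPn => i; rewrite mem_filter => /andP[].
    by move=> i; rewrite mem_cat mem_filter => /orP[/YI|/andP[_ /rI]].
  by move: lt; lra.
by move: in_le out_le; lra.
Qed.

End Limits.

(** * Clipping *)

Section Clip.
Variable R : realType.
Implicit Types e s t : R.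

(** The nearest-point projection onto [-e, e]; s - clip e s is the soft threshold. *)
Definition clip e s := Num.max (- e) (Num.min s e).

Lemma clip_contraction e s t : 0 <= e -> `|clip e t - clip e s| <= `|t - s|.
Proof.
move=> e0; wlog st : s t / s <= t => [th|].
  by have [/th//|/ltW/th] := leP s t; rewrite distrC [leRHS]distrC.
rewrite [leRHS]ger0_norm ?subr_ge0// ler_norml /clip.
by case: (leP s e); case: (leP t e); case: (leP (- e) s); case: (leP (- e) t);
  case: (leP (- e) e) => *; apply/andP; split; lra.
Qed.

Lemma clip_le e s : 0 <= e -> `|clip e s| <= e.
Proof.
move=> e0; rewrite ler_norml /clip.
by case: (leP s e); case: (leP (- e) s); case: (leP (- e) e) => *;
  apply/andP; split; lra.
Qed.

Lemma clip_id e s : `|s| <= e -> clip e s = s.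
Proof.
rewrite ler_norml /clip => /andP[se1 se2].
by case: (leP s e); case: (leP (- e) s); case: (leP (- e) e); lra.
Qed.

End Clip.

(** * The two inclusions *)

Section Inclusions.
Variables (R : realType) (G : groupType) (S : set G).
Implicit Types (p A : R) (f h u v : G -> R).

Lemma energyD_le p f h A1 A2 : 0 <= p -> (energy S p f <= A1%:E)%E ->
  (energy S p h <= A2%:E)%E ->
  (energy S p (f \+ h)%R <= (2 `^ p * (A1 + A2))%:E)%E.
Proof.
move=> p0 /energy_leP fA /energy_leP hA; apply/energy_leP => r ur rS.
rewrite (@le_trans _ _ (\sum_(e <- r)
  2 `^ p * (edge_pow p f e + edge_pow p h e)))//.
  apply: ler_sum => e _; rewrite /edge_pow/= opprD addrACA.
  exact: powR_normD_le.
rewrite -mulr_sumr big_split/= ler_wpM2l ?powR_ge0// lerD//.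
  exact: fA.
exact: hA.
Qed.

(** A nonzero edge starts or ends in the support, and S is finite. *)
Lemma finitely_supported_energy_lty p f : 0 < p -> finite_set S ->
  finitely_supported f -> (energy S p f < +oo)%E.
Proof.
move=> p0 finS finf; set X := [set x | f x != 0] in finf.
pose W : set (G * G) := (X `*` S) `|` [set ((e.1 * e.2^-1)%g, e.2) | e in X `*` S].
have finW : finite_set W.
  have finXS : finite_set (X `*` S) by exact: finite_setX.
  by rewrite finite_setU; split => //; exact: finite_image.
apply/esum_ltyP => [e _|]; first exact: edge_pow_ge0.
exists (\sum_(e <- fset_set W) edge_pow p f e) => r ur rS.
apply: sum_le_support => // [e|[x s] er].
- exact: edge_pow_ge0.
- have [_ /= Ss] := rS _ er; rewrite in_fset_set// notin_setE => nW.
  have fx : f x = 0.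
    by apply: contrapT => /eqP fx; apply: nW; left.
  have fxs : f (x * s)%g = 0.
    apply: contrapT => /eqP fxs; apply: nW; right.
    by exists ((x * s)%g, s) => //=; rewrite mulgK.
  by rewrite /edge_pow/= fx fxs subrr normr0 powR0// gt_eqF.
Qed.

(** The energies along the Cauchy sequence are bounded by comparison with its term
    of index K; the Sobolev inequality bounds the q-sums, and both bounds survive
    in the limit. *)
Lemma D1p_0_sub (N : nat) p : finite_set S -> symmetric_set S -> generates S ->
  polynomial_growth R S N -> 1 <= p -> p < N%:R -> D1p_0 S p `<=` D1p S N p.
Proof.
move=> finS symS genS [C1 [C2 [C10 _ gr]]] p1 pN u [v [finv cauchy vu]].
have p0 : 0 < p by rewrite (lt_le_trans _ p1).
have grl n : (1 <= n)%N -> C1 * n%:R ^+ N <= (growth S n)%:R.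
  by move=> /gr /andP[].
have [C _ sob] := sobolev genS symS p1 pN C10 grl.
have [K Kc] := cauchy 1 ltr01.
have vK := finitely_supported_energy_lty p0 finS (finv K).
pose A := 2 `^ p * (1 + fine (energy S p (v K))).
have vA n : (K <= n)%N -> (energy S p (v n) <= A%:E)%E.
  move=> Kn; have -> : v n = (v n \- v K) \+ v K.
    by apply/funext => x /=; rewrite subrK.
  apply: energyD_le; first exact: ltW.
    have := Kc n K Kn (leqnn K); move/ltW/(energy_le_powR _ _ p0 ler01).
    by rewrite powR1.
  by rewrite fineK// ge0_fin_numE ?energy_ge0.
split.
- rewrite /ell/=; set q := _ / _.
  have q0 : 0 < q by rewrite divr_gt0 ?subr_gt0// mulr_gt0// (lt_trans p0).
  apply: (@le_lt_trans _ _ (C * A `^ (N%:R / (N%:R - p)))%:E); last exact: ltry.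
  apply: (@esum_lim_le _ _ _ (fun n x => `|v n x| `^ q) _ _ K).
  + by move=> n x; exact: powR_ge0.
  + by move=> x; apply: cvg_norm_powR.
  + by move=> n Kn; apply: sob => //; exact: vA.
- apply/(D1p_norm_lty _ _ p0); apply: (@le_lt_trans _ _ A%:E); last exact: ltry.
  apply: (@esum_lim_le _ _ _ (fun n => edge_pow p (v n)) _ _ K).
  + by move=> n e; exact: edge_pow_ge0.
  + by move=> e; apply: cvg_norm_powR => //; apply: cvgB; exact: vu.
  + exact: vA.
Qed.

(** The approximants are the soft thresholds of u at 1/(n + 1). The difference of two
    of them is a difference of clippings of u, whose edge differences are at most
    twice those of u, whence the factor 2^p in the dominating function. *)
Lemma sub_D1p_0 (q p : R) u : 0 < q -> 0 < p ->
  ell q u -> (D1p_norm S p u < +oo)%E -> D1p_0 S p u.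
Proof.
move=> q0 p0 uq /(D1p_norm_lty _ _ p0) uE.
pose e (n : nat) : R := n.+1%:R^-1.
have e0 n : 0 < e n by rewrite invr_gt0.
exists (fun n x => u x - clip (e n) (u x)); split.
- move=> n; apply: sub_finite_set (esum_superlevel_finite _ uq (powR_gt0 q (e0 n))).
    move=> x /= ux; split=> //; rewrite ler_powRl ?(ltW q0) ?(ltW (e0 n))//.
    by rewrite leNgt; apply: contra ux => /ltW/clip_id ->; rewrite subrr.
  by move=> x _; exact: powR_ge0.
- move=> d d0; pose a i := 2 `^ p * edge_pow p u i.
  have a0 i : 0 <= a i by rewrite mulr_ge0 ?powR_ge0.
  have afin : (\esum_(i in [set: G] `*` S) (a i)%:E < +oo)%E.
    apply/esum_ltyP => //; move: uE => /esum_ltyP[e' _|M le].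
      exact: edge_pow_ge0.
    exists (2 `^ p * M) => r ur rS.
    by rewrite -mulr_sumr ler_wpM2l ?powR_ge0//; exact: le.
  have d2 : 0 < d / 2 by rewrite divr_gt0.
  have [c c0 small] := dominated_small_esum a0 afin (powR_gt0 p d2).
  (* Edge differences of the approximants are at most 4 / (K + 1) <= b. *)
  pose b := c `^ p^-1; have b0 : 0 < b by exact: powR_gt0.
  exists (Num.trunc (4 / b)) => m n Km Kn.
  have eb k : (Num.trunc (4 / b) <= k)%N -> e k <= b / 4.
    move=> Kk; rewrite /e -[b / 4]invrK lef_pV2 ?posrE ?invr_gt0 ?divr_gt0//.
    by rewrite invf_div (le_trans (ltW (truncnS_gt _)))// ler_nat.
  apply: (@le_lt_trans _ _ (d / 2)%:E); last by rewrite lte_fin; lra.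
  apply/energy_le_powR => //; first exact: ltW.
  apply: small => [[x s]|[x s]]; rewrite /edge_pow/=.
    rewrite powR_ge0/= /a /edge_pow/= -powRM// ler_powRl ?(ltW p0)//.
    have := clip_contraction (u x) (u (x * s)%g) (ltW (e0 m)).
    have := clip_contraction (u x) (u (x * s)%g) (ltW (e0 n)).
    rewrite !ler_norml => /andP[? ?] /andP[? ?].
    by apply/andP; split; lra.
  have -> : c = b `^ p by rewrite /b -powRrM mulVf ?gt_eqF// powRr1// ltW.
  rewrite ler_powRl ?(ltW p0)//.
  have := eb _ Km; have := eb _ Kn.
  have := clip_le (u x) (ltW (e0 m)); have := clip_le (u (x * s)%g) (ltW (e0 m)).
  have := clip_le (u x) (ltW (e0 n)); have := clip_le (u (x * s)%g) (ltW (e0 n)).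
  rewrite !ler_norml => /andP[? ?] /andP[? ?] /andP[? ?] /andP[? ?] ? ?.
  by apply/andP; split; lra.
- move=> x; apply/cvgrPdist_le => d d0; near=> n.
  rewrite opprB addrC subrK (le_trans (clip_le _ (ltW (e0 n))))//.
  by apply/ltW; near: n; exact: (near_infty_natSinv_lt (PosNum d0)).
Unshelve. all: by end_near. Qed.

End Inclusions.

Theorem theorem8 (R : realType) (G : groupType) (S : set G) (N : nat) (p : R)
    (finS : finite_set S) (symS : symmetric_set S) (genS : generates S)
    (growthS : polynomial_growth R S N) (N_ge3 : (3 <= N)%N)
    (p_gt1 : 1 < p) (p_ltN : p < N%:R) :
  D1p_0 S p = D1p S N p.
Proof.
have p0 : 0 < p by exact: lt_trans p_gt1.
apply/seteqP; split=> [|u [uq uE]]; first by apply: D1p_0_sub => //; exact: ltW.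
apply: sub_D1p_0 uq uE => //.
by rewrite divr_gt0 ?subr_gt0// mulr_gt0// (lt_trans p0).
Qed.
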